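(* The Boltzmann weights (generalised Gamma-Gamma ice) $$a_1(i,j)=t_jz_i+z_j,\quad a_2(i,j)=t_iz_j+z_i,\quad b_1(i,j)=t_iz_j-t_jz_i,\quad b_2(i,j)=z_i-z_j,\quad c_1(i,j)=(t_i+1)z_i,\quad c_2(i,j)=(t_j+1)z_j$$ satisfy the Yang–Baxter equation: for all labels $i,j,k$, all parameters $z_i,z_j,z_k,t_i,t_j,t_k\in\mathbb{C}$ and every orientation $\sigma$ of the six external edges, $Z_A(\sigma)=Z_B(\sigma)$.
   Context: Six-vertex conventions. Lines are drawn in the plane; each line carries a label $\ell$ with a spectral parameter $z_\ell\in\mathbb{C}$ and a deformation parameter $t_\ell\in\mathbb{C}$. Every edge is oriented either ''left'' or ''right''. A vertex is a transversal crossing of an ascending line (lower left to upper right) with label $p$ and a descending line (upper left to lower right) with label $q$; its edges are BL, TR on the ascending line and TL, BR on the descending line. Admissible types: $a_1$: all four edges point left; $a_2$: all point right; $b_1$: BL, TR left and TL, BR right; $b_2$: BL, TR right and TL, BR left; $c_1$: TL, TR left and BL, BR right; $c_2$: TL, TR right and BL, BR left. A vertex of type $x$ has weight $x(p,q)$ (the formula with $(i,j)$ replaced by $(p,q)$); other configurations have weight $0$. Networks. For labels $i,j,k$: external edges $L_k,L_j,L_i$ (left ends) and $R_i,R_j,R_k$ (right ends). Network A: internal edges $e_i,e_j,e_k$; vertex $V_1$ with labels $(p,q)=(j,k)$, BL$=L_j$, TL$=L_k$, TR$=e_j$, BR$=e_k$; $V_2$ with $(i,k)$, BL$=L_i$,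 TL$=e_k$, TR$=e_i$, BR$=R_k$; $V_3$ with $(i,j)$, BL$=e_i$, TL$=e_j$, TR$=R_i$, BR$=R_j$. Network B: internal edges $f_i,f_j,f_k$; $W_1$ with $(i,j)$, BL$=L_i$, TL$=L_j$, TR$=f_i$, BR$=f_j$; $W_2$ with $(i,k)$, BL$=f_i$, TL$=L_k$, TR$=R_i$, BR$=f_k$; $W_3$ with $(j,k)$, BL$=f_j$, TL$=f_k$, TR$=R_j$, BR$=R_k$. $Z_A(\sigma)$, $Z_B(\sigma)$ denote the sums over internal edge orientations of the products of the three vertex weights. *)

(* Defs.v *)
From HB Require Import structures.
From mathcomp Require Import all_boot all_order all_algebra.
From mathcomp Require Import reals complex.

Set Implicit Arguments.
Unset Strict Implicit.
Unset Printing Implicit Defensive.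

Import GRing.Theory.
Local Open Scope ring_scope.

Inductive orientation := left_ | right_.

Definition bool_of_orientation (o : orientation) : bool :=
  if o is left_ then false else true.

Definition orientation_of_bool (b : bool) : orientation :=
  if b then right_ else left_.

Lemma bool_of_orientationK : cancel bool_of_orientation orientation_of_bool.
Proof. by case. Qed.

HB.instance Definition _ :=
  Finite.copy orientation (can_type bool_of_orientationK).

Inductive vertex_type := A1 | A2 | B1 | B2 | C1 | C2.

(* None stands for a configuration that is not admissible. *)
Definition vertex_type_of (BL TL TR BR : orientation) : option vertex_type :=
  match BL, TL, TR, BR with
  | left_,  left_,  left_,  left_  => Some A1
  | right_, right_, right_, right_ => Some A2
  | left_,  right_, left_,  right_ => Some B1
  | right_, left_,  right_, left_  => Some B2
  | right_, left_,  left_,  right_ => Some C1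
  | left_,  right_, right_, left_  => Some C2
  | _, _, _, _ => None
  end.

Definition boltzmann_weights (R : realType) (L : Type) :=
  vertex_type -> L -> L -> R[i].

(* Generalised Gamma-Gamma ice: label l carries the spectral parameter z l
   and the deformation parameter t l. *)
Definition gamma_gamma_ice (R : realType) (L : Type) (z t : L -> R[i]) :
    boltzmann_weights R L :=
  fun x i j =>
    match x with
    | A1 => t j * z i + z j
    | A2 => t i * z j + z i
    | B1 => t i * z j - t j * z i
    | B2 => z i - z j
    | C1 => (t i + 1) * z i
    | C2 => (t j + 1) * z j
    end.

(* p labels the ascending line (edges BL, TR), q the descending line
   (edges TL, BR). *)
Definition vertex_weight (R : realType) (L : Type) (w : boltzmann_weights R L)
    (p q : L) (BL TL TR BR : orientation) : R[i] :=
  if vertex_type_of BL TL TR BR is Some x then w x p q else 0.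

(* The subscripts name the three strands, not their labels, so the six
   external edges remain distinct when some of the labels coincide. *)
Inductive external_edge := L_k | L_j | L_i | R_i | R_j | R_k.

Definition Z_A (R : realType) (L : Type) (w : boltzmann_weights R L)
    (i j k : L) (sigma : external_edge -> orientation) : R[i] :=
  \sum_(e_i : orientation) \sum_(e_j : orientation) \sum_(e_k : orientation)
    vertex_weight w j k (sigma L_j) (sigma L_k) e_j e_k *
    vertex_weight w i k (sigma L_i) e_k e_i (sigma R_k) *
    vertex_weight w i j e_i e_j (sigma R_i) (sigma R_j).

Definition Z_B (R : realType) (L : Type) (w : boltzmann_weights R L)
    (i j k : L) (sigma : external_edge -> orientation) : R[i] :=
  \sum_(f_i : orientation) \sum_(f_j : orientation) \sum_(f_k : orientation)
    vertex_weight w i j (sigma L_i) (sigma L_j) f_i f_j *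
    vertex_weight w i k f_i (sigma L_k) (sigma R_i) f_k *
    vertex_weight w j k f_j f_k (sigma R_j) (sigma R_k).

Definition yang_baxter (R : realType) (L : Type) (w : boltzmann_weights R L) :
    Prop :=
  forall (i j k : L) (sigma : external_edge -> orientation),
    Z_A w i j k sigma = Z_B w i j k sigma.

(* Main.v *)
Require Import Defs.
From mathcomp Require Import all_boot all_order all_algebra.
From mathcomp Require Import reals complex.
From mathcomp Require Import ring.

Import GRing.Theory.

(** The equation is a finite check: 64 boundary orientations, 8 internal states per network. An
    admissible vertex has as many right edges entering from its left as leaving on its right, so
    only 20 boundaries can contribute. *)

Lemma big_orientation (V : nmodType) (F : orientation -> V) :
  (\sum_(o : orientation) F o = F left_ + F right_)%R.
Proof.
(* [big_bool] puts [true], i.e. [right_], first. *)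
rewrite (reindex orientation_of_bool) ?big_bool 1?addrC //=.
by exists bool_of_orientation => [[]|o _]; rewrite ?bool_of_orientationK.
Qed.

Theorem theorem5p1 (R : realType) (L : Type) (z t : L -> R[i]) :
  yang_baxter (gamma_gamma_ice z t).
Proof.
move=> i j k sigma; rewrite /Z_A /Z_B !big_orientation.
case: (sigma L_i); case: (sigma L_j); case: (sigma L_k);
  case: (sigma R_i); case: (sigma R_j); case: (sigma R_k);
  (* Non-conserving boundaries give [0 = 0]; what survives are polynomial identities in the values
     of [z] and [t]. *)
  rewrite /vertex_weight /= ?(mul0r, mulr0, add0r, addr0) //; ring.
Qed.
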